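(* Let $\mathbf{X}=\{X_t\}_{t\in\mathbb{Z}}$ be a stationary sequence of $\mathbb{R}^q$-valued random variables and let $a$ be a positive integer. Then $\beta^d(a)$ converges to $\beta(a)$ as $d\to\infty$.
   Context: Stationary means all finite-dimensional laws are invariant under time shifts. Write $\mathbb{P}_{i:j}$ for the law of $(X_t)_{i\le t\le j}$ and $\|\nu-\lambda\|_{TV}=\sup_A|\nu(A)-\lambda(A)|$ for total variation distance. The $\beta$-mixing coefficient is $$\beta(a)=\|\mathbb{P}_{-\infty:0}\otimes\mathbb{P}_{a:\infty}-\mathbb{P}_{-\infty:0,\,a:\infty}\|_{TV},$$ where $\mathbb{P}_{-\infty:0,\,a:\infty}$ is the joint law of $((X_t)_{t\le 0},(X_t)_{t\ge a})$. For a positive integer $d$, its finite-dimensional version is $$\beta^d(a)=\|\mathbb{P}_{-d+1:0}\otimes\mathbb{P}_{a:(a+d-1)}-\mathbb{P}_{-d+1:0,\,a:(a+d-1)}\|_{TV},$$ where $\mathbb{P}_{-d+1:0,\,a:(a+d-1)}$ is the joint law of the two length-$d$ blocks $(X_{-d+1},\dots,X_0)$ and $(X_a,\dots,X_{a+d-1})$. *)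

(* Defs.v *)
From HB Require Import structures.
From mathcomp Require Import all_boot all_order all_algebra.
From mathcomp Require Import all_classical all_reals all_analysis.

Set Implicit Arguments.
Unset Strict Implicit.
Unset Printing Implicit Defensive.

Import Order.TTheory GRing.Theory Num.Theory.

Local Open Scope classical_set_scope.
Local Open Scope ring_scope.

(* Total variation distance, as an extended real; it is at most 1. *)
Definition tv_dist d (T : measurableType d) (R : realType)
    (nu lam : probability T R) : \bar R :=
  ereal_sup [set `|nu A - lam A|%E | A in @measurable d T].

(* [paths J E] is the set of functions J -> E with the product sigma-algebra,
   i.e. the one generated by the one-coordinate cylinders. *)
Definition cylinders (J : Type) d (E : measurableType d) : set (set (J -> E)) :=
  [set (fun f : J -> E => f j) @^-1` B | j in [set: J] & B in measurable].

Notation paths J E := (g_sigma_algebraType (@cylinders J _ E)).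

Definition window (I : interval int) := {t : int | t \in I}.

Section process.
Context d d' (Omega : measurableType d) (E : measurableType d') (R : realType)
  (P : probability Omega R) (X : int -> {RV P >-> E}).

Definition at_times n (ts : n.-tuple int) (w : Omega) : n.-tuple E :=
  [tuple X (tnth ts i) w | i < n].

Lemma measurable_at_times n (ts : n.-tuple int) :
  measurable_fun [set: Omega] (at_times ts).
Proof.
apply/measurable_fun_tnthP => i.
rewrite (_ : _ \o _ = X (tnth ts i)); first exact: measurable_funPT.
by apply/funext => w /=; rewrite tnth_mktuple.
Qed.

HB.instance Definition _ n (ts : n.-tuple int) :=
  isMeasurableFun.Build _ _ _ _ (at_times ts) (measurable_at_times ts).

Definition stationary :=
  forall (n : nat) (ts : n.-tuple int) (h : int) (A : set (n.-tuple E)),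
    measurable A ->
    distribution P (at_times (map_tuple (fun t => t + h) ts)) A =
    distribution P (at_times ts) A.

(* [distribution P (block X I)] is the law of (X_t) for t in I, where I may be
   unbounded. *)
Definition block (I : interval int) (w : Omega) : paths (window I) E :=
  fun t => X (val t) w.
Arguments block : clear implicits.

Lemma measurable_block I : measurable_fun [set: Omega] (block I).
Proof.
apply: measurability => //.
move=> _ [_ [t _ [B mB <-]] <-].
by rewrite /= setTI; have := measurable_funPT (X (val t)) measurableT _ mB;
  rewrite setTI.
Qed.

HB.instance Definition _ I :=
  isMeasurableFun.Build _ _ _ _ (block I) (@measurable_block I).

Definition joint_block (I J : interval int) (w : Omega) :
  (paths (window I) E * paths (window J) E)%type := (block I w, block J w).
Arguments joint_block : clear implicits.

Lemma measurable_joint_block I J :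
  measurable_fun [set: Omega] (joint_block I J).
Proof. by apply: measurable_fun_pair; exact: measurable_block. Qed.

HB.instance Definition _ I J :=
  isMeasurableFun.Build _ _ _ _ (joint_block I J) (@measurable_joint_block I J).

(* Distance between the product of the laws of the blocks over I and J and
   their joint law. *)
Definition dependence (I J : interval int) : \bar R :=
  tv_dist (distribution P (block I) \x distribution P (block J))%E
          (distribution P (joint_block I J)).

Definition beta_mixing (a : int) : \bar R := dependence `]-oo, 0] `[a, +oo[.

(* Only k > 0 is meaningful: for k = 0 both blocks are empty. *)
Definition beta_mixing_fin (k : nat) (a : int) : \bar R :=
  dependence `[- k%:Z + 1, 0] `[a, a + k%:Z - 1].

End process.

Arguments block {d d' Omega E R P} X I w.
Arguments joint_block {d d' Omega E R P} X I J w.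

(* Main.v *)
(* The dependence between two blocks is monotone in the blocks, since restricting
   a path maps the product law to the product law and the joint law to the joint
   law. The events determined by the finite blocks form an algebra that
   generates the product sigma-algebra, so every event is approximated by such
   events simultaneously under both laws; hence the total variation distance of
   the infinite blocks is the supremum over the finite ones. *)
Require Import Defs.
From HB Require Import structures.
From mathcomp Require Import all_boot all_order all_algebra.
From mathcomp Require Import all_classical all_reals all_analysis.
From mathcomp Require Import lra zify.

Set Implicit Arguments.
Unset Strict Implicit.
Unset Printing Implicit Defensive.

Import Order.TTheory GRing.Theory Num.Theory.

Local Open Scope classical_set_scope.
Local Open Scope ring_scope.

(** * Approximation of events by an algebra, and its effect on total variation *)

Section approximation.
Context d (T : measurableType d) (R : realType).
Implicit Types F : set (set T).

(** The closure of [F] in the pseudometric $\mu(A \triangle B)$. Measurability is bundled in so that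
    the whole class can be shown to be a sigma-algebra. *)
Definition approximable (mu : {measure set T -> \bar R}) F (A : set T) : Prop :=
  measurable A /\
  forall e : R, 0 < e -> exists2 B, F B & (mu (A `+` B) < e%:E)%E.

Lemma measurable_setY (A B : set T) :
  measurable A -> measurable B -> measurable (A `+` B).
Proof.
by move=> mA mB; rewrite setY_def; apply: measurableU; exact: measurableD.
Qed.

Section algebra.
Variables (mu : {measure set T -> \bar R}) (F : set (set T)).
Hypotheses (mu_fin : (mu setT < +oo)%E) (mF : F `<=` measurable).
Hypotheses (F0 : F set0) (FC : setC_closed F) (FU : setU_closed F).

Lemma approximable_mem A : F A -> approximable mu F A.
Proof.
move=> FA; split; first exact: mF.
by move=> e e0; exists A => //; rewrite setYK measure0.
Qed.

Lemma approximableC A : approximable mu F A -> approximable mu F (~` A).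
Proof.
move=> [mA AF]; split; first exact: measurableC.
move=> e /AF [B FB AB]; exists (~` B); first exact: FC.
(* Complement is symmetric difference with [setT], and the two copies of [setT] cancel. *)
by rewrite -setYTC -(setYTC B) [B `+` _]setYC setYA -(setYA A) setYK setY0.
Qed.

(** Rests on $(A \cup A') \triangle (B \cup B') \subseteq (A \triangle B) \cup (A' \triangle B')$,
    with half of the error spent on each set. *)
Lemma approximableU A A' :
  approximable mu F A -> approximable mu F A' -> approximable mu F (A `|` A').
Proof.
move=> [mA AF] [mA' AF']; split; first exact: measurableU.
move=> e e0; have e2 : 0 < e / 2 by rewrite divr_gt0.
have [B FB AB] := AF _ e2; have [B' FB' AB'] := AF' _ e2.
have mB := mF FB; have mB' := mF FB'.
exists (B `|` B'); first exact: FU.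
have -> : e%:E = ((e / 2)%:E + (e / 2)%:E)%E by rewrite -EFinD -splitr.
apply: le_lt_trans (lteD AB AB').
apply: le_trans (measureU2 _ _ _); try exact: measurable_setY.
apply: le_measure; rewrite ?inE.
- by apply: measurable_setY; exact: measurableU.
- by apply: measurableU; exact: measurable_setY.
- move=> x; rewrite !setY_def /=; tauto.
Qed.

(** The finite unions [S n] are approximable, and the remainders [D n] decrease to the empty set, so
    finiteness of [mu] makes their measure tend to 0. *)
Lemma approximable_bigcup (A : (set T)^nat) :
  (forall n, approximable mu F (A n)) -> approximable mu F (\bigcup_n A n).
Proof.
move=> AF; have mA n : measurable (A n) by have [] := AF n.
pose S n := \big[setU/set0]_(i < n.+1) A i.
have SF n : approximable mu F (S n).
  by apply: big_ind => //; [exact: approximable_mem|exact: approximableU].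
have mS n : measurable (S n) by have [] := SF n.
have mUA : measurable (\bigcup_n A n) by exact: bigcup_measurable.
split => // e e0; have e2 : 0 < e / 2 by rewrite divr_gt0.
pose D n := \bigcup_n A n `\` S n.
have mD n : measurable (D n) by exact: measurableD.
have capD : \bigcap_n D n = set0.
  rewrite -subset0 => x Dx; have [+ _] := Dx 0%N I.
  by rewrite -bigcup_bigsetU_bigcup => -[n _ Sx]; have [_] := Dx n I.
have /(_ [set y | (y < (e / 2)%:E)%E]) : mu (D n) @[n --> \oo] --> 0%E.
  rewrite -(measure0 mu) -capD; apply: nonincreasing_cvg_mu => //.
  - by apply: le_lt_trans mu_fin; apply: le_measure; rewrite ?inE.
  - by rewrite capD; exact: measurable0.
  - move=> m n mn; apply/subsetPset; apply: setDS.
    exact: subset_bigsetU.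
have : nbhs 0%E [set y : \bar R | (y < (e / 2)%:E)%E].
  by apply: open_ereal_lt'; rewrite lte_fin.
move=> /[swap] /[apply] -[n _ /(_ n (leqnn n)) /= Dn].
have [B FB SB] := (SF n).2 _ e2; have mB := mF FB; exists B => //.
have -> : e%:E = ((e / 2)%:E + (e / 2)%:E)%E by rewrite -EFinD -splitr.
apply: le_lt_trans (lteD Dn SB).
apply: le_trans (measureU2 _ _ _) => //; last exact: measurable_setY.
apply: le_measure; rewrite ?inE.
- exact: measurable_setY.
- by apply: measurableU => //; exact: measurable_setY.
(* Since [S n] lies in the full union, a point of the union's symmetric difference with [B] is in
   [D n] or in [S n] $\triangle$ [B]. *)
- have := @bigsetU_bigcup _ A n.+1; rewrite -/(S n) => SA x.
  rewrite !setY_def /D /=; have := SA x; have := pselect (S n x); tauto.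
Qed.

Lemma sigma_approximable : <<s F >> `<=` approximable mu F.
Proof.
apply: smallest_sub; last exact: approximable_mem.
split.
- exact: approximable_mem.
- by move=> A; rewrite setTD; exact: approximableC.
- exact: approximable_bigcup.
Qed.

End algebra.

(** Because $A \subseteq B \cup (A \triangle B)$. Stated with [fine] so that the estimates below
    become real linear arithmetic. *)
Lemma le_probability_setY (P : probability T R) (A B : set T) :
  measurable A -> measurable B ->
  fine (P A) <= fine (P B) + fine (P (A `+` B)).
Proof.
move=> mA mB; have mAB := measurable_setY mA mB.
rewrite -lee_fin EFinD !fineK ?fin_num_measure //.
apply: le_trans (measureU2 _ _ _) => //.
apply: le_measure; rewrite ?inE //; first exact: measurableU.
move=> x; rewrite setY_def /=; have := pselect (B x); tauto.
Qed.

Lemma tv_dist_le_algebra (mu nu : probability T R) F (c : \bar R) :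
    F `<=` measurable -> F set0 -> setC_closed F -> setU_closed F ->
    measurable `<=` <<s F >> ->
    (forall B, F B -> (`|mu B - nu B| <= c)%E) ->
  (tv_dist mu nu <= c)%E.
Proof.
move=> mF F0 FC FU genF Fc; apply: ge_ereal_sup => _ [A mA <-].
apply/lee_addgt0Pr => e e0.
(* Approximating under the sum, which is still finite, yields one [B] close to [A] under both laws
   at once. *)
pose m := measure_add mu nu : {measure set T -> \bar R}.
have mE C : m C = (mu C + nu C)%E by exact: measure_addE.
have m_fin : (m setT < +oo)%E.
  by rewrite mE !probability_setT -EFinD ltry.
have [_ /(_ _ e0)[B FB]] := sigma_approximable m_fin mF F0 FC FU (genF _ mA).
have mB := mF _ FB; have mY := measurable_setY mA mB.
rewrite mE => mAB.
apply: (@le_trans _ _ (`|mu B - nu B| + e%:E)%E); last first.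
  by rewrite leeD2r // Fc.
have fin (P : probability T R) (C : set T) (mC : measurable C) :=
  fineK (fin_num_measure P _ mC).
(* The four inequalities bound $|\mu A - \mu B|$ and $|\nu A - \nu B|$ by the respective measures of
   $A \triangle B$, whose sum is below [e]. *)
have := le_probability_setY mu mA mB; have := le_probability_setY mu mB mA.
have := le_probability_setY nu mA mB; have := le_probability_setY nu mB mA.
move: mAB; rewrite ![B `+` A]setYC.
rewrite -(fin mu A) // -(fin mu B) // -(fin nu A) // -(fin nu B) //.
rewrite -(fin mu (A `+` B)) // -(fin nu (A `+` B)) //.
rewrite -!EFinD !lte_fin !lee_fin /=.
move: (fine _) (fine _) (fine (mu A)) (fine (mu B)) (fine (nu A)) (fine (nu B)).
move=> x y a b a' b' *; rewrite -lerBlDr.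
have := lerB_dist (a - a') (b - b').
have : `|(a - a') - (b - b')| <= e by rewrite ler_norml; lra.
lra.
Qed.
End approximation.

(** * Restriction of paths to smaller windows *)

Section windows.
Context d d' (Omega : measurableType d) (E : measurableType d') (R : realType)
  (P : probability Omega R) (X : int -> {RV P >-> E}).
Implicit Types I J : interval int.

Definition restrict_path I I' (sI : {subset I <= I'})
    (f : paths (window I') E) : paths (window I) E :=
  fun t => f (exist _ (val t) (sI _ (valP t))).

Lemma measurable_restrict_path I I' (sI : {subset I <= I'}) :
  measurable_fun setT (restrict_path sI).
Proof.
apply: measurability => // _ [_ [t _ [B mB <-]] <-].
rewrite setTI; apply: sub_sigma_algebra.
by exists (exist _ (val t) (sI _ (valP t))) => //; exists B.
Qed.

Definition restrict_paths I I' J J' (sI : {subset I <= I'})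
    (sJ : {subset J <= J'}) (p : paths (window I') E * paths (window J') E) :
    (paths (window I) E * paths (window J) E)%type :=
  (restrict_path sI p.1, restrict_path sJ p.2).

Lemma measurable_restrict_paths I I' J J' (sI : {subset I <= I'})
    (sJ : {subset J <= J'}) : measurable_fun setT (restrict_paths sI sJ).
Proof.
apply: measurable_fun_pair.
- exact: measurableT_comp (measurable_restrict_path sI) measurable_fst.
- exact: measurableT_comp (measurable_restrict_path sJ) measurable_snd.
Qed.

HB.instance Definition _ I I' J J' (sI : {subset I <= I'})
    (sJ : {subset J <= J'}) :=
  isMeasurableFun.Build _ _ _ _ (restrict_paths sI sJ)
    (measurable_restrict_paths sI sJ).

Definition product_law I J : probability _ R :=
  (distribution P (block X I) \x distribution P (block X J))%E.

Definition joint_law I J : probability _ R :=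
  distribution P (joint_block X I J).

Lemma dependenceE I J :
  dependence X I J = tv_dist (product_law I J) (joint_law I J).
Proof. by []. Qed.

Lemma product_law_restrict I I' J J' (sI : {subset I <= I'})
    (sJ : {subset J <= J'}) B : measurable B ->
  product_law I J B = product_law I' J' (restrict_paths sI sJ @^-1` B).
Proof.
(* By uniqueness of the product measure, this pushforward need only be compared on rectangles, whose
   preimages under restriction are again rectangles. *)
pose law : {measure set _ -> \bar R} :=
  distribution (product_law I' J') (restrict_paths sI sJ).
apply: (@product_measure_unique _ _ _ _ _ _ _ law) => B1 B2 mB1 mB2.
have mC1 : measurable (restrict_path sI @^-1` B1).
  by rewrite -[X in measurable X]setTI; exact: measurable_restrict_path.
have mC2 : measurable (restrict_path sJ @^-1` B2).
  by rewrite -[X in measurable X]setTI; exact: measurable_restrict_path.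
exact: (@product_measure1E _ _ _ _ _ (distribution P (block X I'))
  (distribution P (block X J')) _ _ mC1 mC2).
Qed.

(** Restricting [joint_block X I' J'] gives [joint_block X I J] by computation. *)
Lemma joint_law_restrict I I' J J' (sI : {subset I <= I'})
    (sJ : {subset J <= J'}) B :
  joint_law I J B = joint_law I' J' (restrict_paths sI sJ @^-1` B).
Proof. by []. Qed.

Lemma dependence_mono I I' J J' : {subset I <= I'} -> {subset J <= J'} ->
  (dependence X I J <= dependence X I' J')%E.
Proof.
move=> sI sJ; rewrite !dependenceE; apply: ge_ereal_sup => _ [B mB <-].
rewrite (product_law_restrict sI sJ mB) (joint_law_restrict sI sJ).
apply: ereal_sup_ubound; exists (restrict_paths sI sJ @^-1` B) => //.
by rewrite -[X in measurable X]setTI; exact: measurable_restrict_paths.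
Qed.

(** * Convergence along windows that exhaust the index sets *)

Section exhaustion.
Variables (I J : nat -> interval int) (I' J' : interval int).
Hypotheses (I_mono : forall m n, (m <= n)%N -> {subset I m <= I n})
  (J_mono : forall m n, (m <= n)%N -> {subset J m <= J n}).
Hypotheses (sI : forall n, {subset I n <= I'})
  (sJ : forall n, {subset J n <= J'}).
Hypotheses (I_cover : forall t, t \in I' -> exists n, t \in I n)
  (J_cover : forall t, t \in J' -> exists n, t \in J n).

Definition finitely_determined :
    set (set (paths (window I') E * paths (window J') E)) :=
  [set A | exists n B, measurable B /\
    A = restrict_paths (@sI n) (@sJ n) @^-1` B].

(** Brings two events to a common stage, which closure under union requires. *)
Lemma finitely_determined_le m n B : (m <= n)%N -> measurable B ->
  exists2 C, measurable C &
    restrict_paths (@sI m) (@sJ m) @^-1` B =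
    restrict_paths (@sI n) (@sJ n) @^-1` C.
Proof.
move=> mn mB; exists (restrict_paths (@I_mono _ _ mn) (@J_mono _ _ mn) @^-1` B).
  by rewrite -[X in measurable X]setTI; exact: measurable_restrict_paths.
(* Restricting in one step or in two reads the same coordinates, up to the proofs of membership in
   the window. *)
rewrite -comp_preimage; congr (_ @^-1` B); apply/funext => -[f g].
congr pair; apply/funext => t; rewrite /restrict_path /=.
- by congr f; exact: val_inj.
- by congr g; exact: val_inj.
Qed.

Lemma measurable_finitely_determined : finitely_determined `<=` measurable.
Proof.
move=> _ [n [B [mB ->]]].
by rewrite -[X in measurable X]setTI; exact: measurable_restrict_paths.
Qed.

Lemma finitely_determinedC : setC_closed finitely_determined.
Proof.
move=> _ [n [B [mB ->]]]; exists n, (~` B); split => //.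
exact: measurableC.
Qed.

Lemma finitely_determinedU : setU_closed finitely_determined.
Proof.
move=> _ _ [m [A [mA ->]]] [n [B [mB ->]]].
have [A' mA' ->] := finitely_determined_le (leq_maxl m n) mA.
have [B' mB' ->] := finitely_determined_le (leq_maxr m n) mB.
by exists (maxn m n), (A' `|` B'); split => //; exact: measurableU.
Qed.

(** It suffices to treat one-coordinate cylinders in either factor, and by the covering hypotheses
    each coordinate already belongs to some finite stage. *)
Lemma finitely_determined_generates :
  measurable `<=` <<s finitely_determined >>.
Proof.
apply: smallest_sub; first exact: smallest_sigma_algebra.
(* Used for both projections: the sets whose preimage under [pr] is generated form a sigma-algebra,
   so cylinders are enough. *)
have gen (K : interval int)
    (pr : paths (window I') E * paths (window J') E -> paths (window K) E) :
    (forall (t : window K) (C : set E), measurable C ->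
      finitely_determined (pr @^-1` ((fun f => f t) @^-1` C))) ->
  forall C, measurable C -> <<s finitely_determined >> (pr @^-1` C).
  move=> prF; apply: smallest_sub.
    split.
    - by rewrite preimage_set0; exact: sigma_algebra0.
    - by move=> C; rewrite setTD preimage_setC; exact: sigma_algebraC.
    - by move=> C hC; rewrite preimage_bigcup; exact: sigma_algebra_bigcup.
  by move=> _ [t _ [C mC <-]]; apply: sub_sigma_algebra; exact: prF.
move=> _ [[C mC <-]|[C mC <-]]; rewrite setTI.
- apply: (gen I') => // -[t tI'] B mB; have [n tn] := I_cover tI'.
  (* The same cylinder, read in the smaller window. *)
  pose B' := (fun f : paths (window (I n)) E => f (exist _ t tn)) @^-1` B.
  exists n, (fst @^-1` B'); split.
    rewrite -[X in measurable X]setTI; apply: measurable_fst => //.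
    by apply: sub_sigma_algebra; exists (exist _ t tn) => //; exists B.
  by apply/funext => -[f g]; congr B; congr f; exact: val_inj.
- apply: (gen J') => // -[t tJ'] B mB; have [n tn] := J_cover tJ'.
  pose B' := (fun f : paths (window (J n)) E => f (exist _ t tn)) @^-1` B.
  exists n, (snd @^-1` B'); split.
    rewrite -[X in measurable X]setTI; apply: measurable_snd => //.
    by apply: sub_sigma_algebra; exists (exist _ t tn) => //; exists B.
  by apply/funext => -[f g]; congr B; congr g; exact: val_inj.
Qed.

Lemma dependence_cvg :
  dependence X (I n) (J n) @[n --> \oo] --> dependence X I' J'.
Proof.
have mono : {homo (fun n => dependence X (I n) (J n)) : m n / (m <= n)%N >->
    (m <= n)%E}.
  by move=> m n mn; apply: dependence_mono; [exact: I_mono|exact: J_mono].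
(* A nondecreasing sequence tends to its supremum, so the limit is identified with that supremum. *)
have -> : dependence X I' J' =
    ereal_sup (range (fun n => dependence X (I n) (J n))).
  apply/eqP; rewrite eq_le; apply/andP; split; last first.
    by apply: ge_ereal_sup => _ [n _ <-]; exact: dependence_mono.
  rewrite dependenceE; apply: (tv_dist_le_algebra measurable_finitely_determined).
  - by exists 0%N, set0; split => //; rewrite preimage_set0.
  - exact: finitely_determinedC.
  - exact: finitely_determinedU.
  - exact: finitely_determined_generates.
  move=> _ [n [B [mB ->]]].
  apply: (@le_trans _ _ (dependence X (I n) (J n))); last first.
    by apply: ereal_sup_ubound; exists n.
  rewrite dependenceE -(product_law_restrict _ _ mB) -joint_law_restrict.
  by apply: ereal_sup_ubound; exists B.
exact: ereal_nondecreasing_cvgn.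
Qed.

End exhaustion.
End windows.

Theorem lemma13 (d : measure_display) (Omega : measurableType d) (R : realType)
    (P : probability Omega R) (q : nat) (X : int -> {RV P >-> q.-tuple R})
    (statX : stationary X) (a : int) (a_gt0 : 0 < a) :
  beta_mixing_fin X k a @[k --> \oo] --> beta_mixing X a.
Proof.
apply: (@dependence_cvg _ _ _ _ _ _ X (fun k => `[- k%:Z + 1, 0])
  (fun k => `[a, a + k%:Z - 1]) `]-oo, 0] `[a, +oo[).
(* Nesting holds from [k = 0] on, where both windows are empty. *)
- by move=> m n mn t; rewrite !in_itv /=; lia.
- by move=> m n mn t; rewrite !in_itv /=; lia.
- by move=> n t; rewrite !in_itv /=; lia.
- by move=> n t; rewrite !in_itv /=; lia.
(* With $k = |t| + 1$ the left end $-k + 1$ is $-|t|$, which is [t] itself as $t \le 0$; below, $k =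
   |t - a| + 1$ likewise makes [t] the right end. *)
- move=> t; rewrite in_itv /= => t0; exists (`|t| + 1)%N.
  by rewrite in_itv /=; lia.
- move=> t; rewrite in_itv /= => t0; exists (`|t - a| + 1)%N.
  by rewrite in_itv /=; lia.
Qed.
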